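(* Let $K$ be a complex cubic field, let $1,\alpha_1,\alpha_2$ be a $\mathbf{Z}$-basis of $\mathcal{O}_K$, let $M(x,y)=\sum_{i=1}^3|\sigma_i(x\alpha_1^\perp+y\alpha_2^\perp)|^2$ and $T(x,y)=\mathrm{Tr}_{K/\mathbf{Q}}\big((x\alpha_1^\perp+y\alpha_2^\perp)^2\big)$. Then the shape of $K$, i.e. the image of $z(M)$ in $\mathrm{GL}_2(\mathbf{Z})\backslash\mathfrak{H}$, lies on the image in $\mathrm{GL}_2(\mathbf{Z})\backslash\mathfrak{H}$ of the geodesic $\gamma_T$ associated to the indefinite binary quadratic form $T$ (the trace-zero form $T_K^\perp$).
   Context: A complex cubic field is a degree-3 number field with one real embedding and one pair of complex embeddings; $\sigma_1,\sigma_2,\sigma_3$ denote its embeddings into $\mathbf{C}$, and $\alpha^\perp:=3\alpha-\mathrm{Tr}_{K/\mathbf{Q}}(\alpha)$. For a positive definite real form $Q=rx^2+sxy+ty^2$, $z(Q)=\frac{s}{2r}+i\frac{\sqrt{4rt-s^2}}{2r}\in\mathfrak{H}$. For an indefinite real binary quadratic form $Q$, write $Q$ as a product of two real linear forms, vanishing at points $\rho_\pm=[u_\pm:v_\pm]\in\mathbf{P}^1(\mathbf{R})$, identified with $u_\pm/v_\pm\in\mathbf{R}\cup\{\infty\}$; the geodesic $\gamma_Q\subset\mathfrak{H}$ is the semicircle with diameter joining $\rho_+$ and $\rho_-$ if both are finite, and otherwise the vertical half-line from the finite one to $\infty$. $\mathrm{GL}_2(\mathbf{Z})$ acts on $\mathfrak{H}$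 by $z\mapsto\frac{az+b}{cz+d}$ if the determinant is $1$ and $z\mapsto\frac{a\bar z+b}{c\bar z+d}$ if it is $-1$. *)

(* Defs.v *)
From HB Require Import structures.
From mathcomp Require Import all_boot all_order all_algebra all_field.
From mathcomp Require Import complex.
From mathcomp Require Import mathcomp_extra boolp classical_sets reals.
From mathcomp Require Import ring.

Set Implicit Arguments.
Unset Strict Implicit.
Unset Printing Implicit Defensive.
Import Order.TTheory GRing.Theory Num.Theory ComplexField.

Local Open Scope complex_scope.
Local Open Scope classical_set_scope.
Local Open Scope ring_scope.

Record bqf (A : Type) := Bqf { bqf_r : A; bqf_s : A; bqf_t : A }.

Definition bqf_eval (A : comPzRingType) (Q : bqf A) (x y : A) : A :=
  bqf_r Q * x ^+ 2 + bqf_s Q * (x * y) + bqf_t Q * y ^+ 2.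

Definition map_bqf (A B : Type) (f : A -> B) (Q : bqf A) : bqf B :=
  Bqf (f (bqf_r Q)) (f (bqf_s Q)) (f (bqf_t Q)).

(* The only form that can agree with the function f: its coefficients are read
   off from the values at (1,0), (0,1) and (1,1).  That f is indeed given by
   this form is proved below for the two functions of interest
   ([minkowski_formE], [trace_zero_formE]). *)
Definition bqf_of_fun (A : comPzRingType) (f : rat -> rat -> A) : bqf A :=
  Bqf (f 1 0) (f 1 1 - f 1 0 - f 0 1) (f 0 1).

Definition positive_definite (R : realType) (Q : bqf R) : Prop :=
  forall x y : R, (x, y) <> (0, 0) -> 0 < bqf_eval Q x y.

Definition indefinite (R : realType) (Q : bqf R) : Prop :=
  (exists x y : R, 0 < bqf_eval Q x y) /\ (exists x y : R, bqf_eval Q x y < 0).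

Definition upper_half_plane (R : realType) : set R[i] := [set z | 0 < complex.Im z].

(* The sign convention is s/(2r), not -s/(2r): z(Q) is a root of Q(x, -1). *)
Definition bqf_point (R : realType) (Q : bqf R) : R[i] :=
  let: Bqf r s t := Q in
  (s / (2 * r)) +i* (Num.sqrt (4 * r * t - s ^+ 2) / (2 * r)).

Lemma bqf_point_in (R : realType) (Q : bqf R) :
  positive_definite Q -> upper_half_plane (bqf_point Q).
Proof.
case: Q => r s t Qpos.
have r_gt0 : 0 < r.
  have /Qpos : (1, 0) <> (0, 0) :> R * R by case=> /eqP; rewrite oner_eq0.
  by rewrite /bqf_eval /= expr1n mulr0 expr0n /= !mulr0 mulr1 !addr0.
have /Qpos : (s, - (2 * r)) <> (0, 0) :> R * R.
  by case=> _ /eqP; rewrite oppr_eq0 mulf_eq0 pnatr_eq0 (gt_eqF r_gt0).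
rewrite /bqf_eval /=.
have -> : r * s ^+ 2 + s * (s * - (2 * r)) + t * (- (2 * r)) ^+ 2
          = r * (4 * r * t - s ^+ 2) by ring.
rewrite pmulr_rgt0 // => d_gt0.
by apply: divr_gt0; rewrite ?sqrtr_gt0 // mulr_gt0 ?ltr0n.
Qed.

Definition GL2Z_act (R : realType) (g : 'M[int]_2) (z : R[i]) : R[i] :=
  let w := if \det g == 1 then z else conjc z in
  ((g 0 0)%:~R * w + (g 0 1)%:~R) / ((g 1 0)%:~R * w + (g 1 1)%:~R).

(* z |-> GL2Z_orbit z is the projection from the upper half-plane to its
   quotient by GL_2(Z). *)
Definition GL2Z_orbit (R : realType) (z : R[i]) : set R[i] :=
  [set GL2Z_act g z | g in [set g : 'M[int]_2 | g \in unitmx]].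

Definition lin_eval (R : realType) (l p : R * R) : R := l.1 * p.1 + l.2 * p.2.

(* [None] is the point at infinity [1 : 0]. *)
Definition P1_affine (R : realType) (p : R * R) : option R :=
  if p.2 == 0 then None else Some (p.1 / p.2).

Definition geodesic_between (R : realType) (p q : option R) : set R[i] :=
  match p, q with
  | Some a, Some b =>
      [set z | upper_half_plane z /\
               Normc.normc (z - ((a + b) / 2)%:C) = `|a - b| / 2]
  | Some a, None | None, Some a => [set z | upper_half_plane z /\ complex.Re z = a]
  | None, None => set0
  end.

(* The factorization of an indefinite form into linear forms is unique up to
   order and scaling, so that the existential does not enlarge the set. *)
Definition geodesic (R : realType) (Q : bqf R) : set R[i] :=
  [set z | exists l1 l2 p1 p2 : R * R,
     [/\ forall x y, bqf_eval Q x y = lin_eval l1 (x, y) * lin_eval l2 (x, y),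
         p1 <> (0, 0) /\ lin_eval l1 p1 = 0,
         p2 <> (0, 0) /\ lin_eval l2 p2 = 0
       & geodesic_between (P1_affine p1) (P1_affine p2) z]].

Definition field_trace (K : fieldExtType rat) (a : K) : rat :=
  let e := vbasis {:K} in \tr (passmx.mxof e e (amull a)).

Definition real_embedding (R : realType) (K : fieldExtType rat)
    (s : {rmorphism K -> R[i]}) : Prop :=
  forall a, s a \is Num.real.

Definition complex_cubic_field (R : realType) (K : fieldExtType rat) : Prop :=
  [/\ \dim {:K} = 3%N,
      exists s : {rmorphism K -> R[i]}, real_embedding s /\
        forall s' : {rmorphism K -> R[i]}, real_embedding s' -> s' =1 s
    & exists s : {rmorphism K -> R[i]}, ~ real_embedding s /\
        forall s' : {rmorphism K -> R[i]}, ~ real_embedding s' ->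
          s' =1 s \/ s' =1 (fun a => conjc (s a))].

Definition all_embeddings (R : realType) (K : fieldExtType rat) (n : nat)
    (sigma : 'I_n -> {rmorphism K -> R[i]}) : Prop :=
  (forall i j, sigma i =1 sigma j -> i = j) /\
  (forall s : {rmorphism K -> R[i]}, exists i, s =1 sigma i).

Definition algebraic_integer (K : fieldExtType rat) (a : K) : Prop :=
  integralOver (intr : int -> K) a.

Definition integral_basis (K : fieldExtType rat) (n : nat)
    (e : n.-tuple K) : Prop :=
  (forall i, algebraic_integer (tnth e i)) /\
  (forall a, algebraic_integer a ->
     exists! c : 'rV[int]_n, a = \sum_(i < n) tnth e i *~ c 0 i).

Definition perp (K : fieldExtType rat) (a : K) : K :=
  3 *: a - (field_trace a)%:A.

Definition minkowski_form (R : realType) (K : fieldExtType rat)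
    (sigma : 'I_3 -> {rmorphism K -> R[i]}) (a1 a2 : K) : bqf R :=
  bqf_of_fun (fun x y =>
    \sum_(i < 3) Normc.normc (sigma i (x *: perp a1 + y *: perp a2)) ^+ 2).

Definition trace_zero_form (K : fieldExtType rat) (a1 a2 : K) : bqf rat :=
  bqf_of_fun (fun x y => field_trace ((x *: perp a1 + y *: perp a2) ^+ 2)).

Lemma minkowski_formE (R : realType) (K : fieldExtType rat)
    (sigma : 'I_3 -> {rmorphism K -> R[i]}) (a1 a2 : K) (x y : rat) :
  bqf_eval (minkowski_form sigma a1 a2) (ratr x) (ratr y) =
  \sum_(i < 3) Normc.normc (sigma i (x *: perp a1 + y *: perp a2)) ^+ 2.
Proof.
rewrite /bqf_eval /minkowski_form /bqf_of_fun /= -!sumrB !mulr_suml -!big_split /=.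
apply: eq_bigr => i _.
have sE u v : sigma i (u *: perp a1 + v *: perp a2) =
    (ratr u)%:C * sigma i (perp a1) + (ratr v)%:C * sigma i (perp a2).
  have sZ w b : sigma i (w *: b) = (ratr w)%:C * sigma i b.
    rewrite -mulr_algl rmorphM; congr (_ * _).
    by rewrite fmorph_rat; exact: (fmorph_eq_rat (sigma i \o in_alg K)).
  by rewrite rmorphD /= !sZ.
rewrite !sE; case: (sigma i (perp a1)) (sigma i (perp a2)) => [a b] [c d].
rewrite !rmorph0 !rmorph1 !mul0r !mul1r addr0 add0r; simpc.
have nE (p q : R) : Normc.normc (p +i* q) ^+ 2 = p ^+ 2 + q ^+ 2.
  by rewrite /= sqr_sqrtr // addr_ge0 ?sqr_ge0.
rewrite !nE; ring.
Qed.

Lemma trace_zero_formE (K : fieldExtType rat) (a1 a2 : K) (x y : rat) :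
  bqf_eval (trace_zero_form a1 a2) x y =
  field_trace ((x *: perp a1 + y *: perp a2) ^+ 2).
Proof.
have tP c (u v : K) :
    field_trace (c *: u + v) = c * field_trace u + field_trace v :> rat.
  by rewrite /field_trace /= linearP passmx.mxof_linear mxtraceD mxtraceZ.
have tD : {morph @field_trace K : u v / u + v}.
  by move=> u v; rewrite -[u]scale1r tP mul1r scale1r.
have t0 : field_trace (0 : K) = 0.
  by have := tP (-1) 0 0; rewrite scaler0 addr0 mulN1r addNr.
have tZ c (u : K) : field_trace (c *: u) = c * field_trace u :> rat.
  by rewrite -[c *: u]addr0 tP t0 addr0.
rewrite /bqf_eval /trace_zero_form /bqf_of_fun /=.
have fE u v : field_trace ((u *: perp a1 + v *: perp a2) ^+ 2) =
    u ^+ 2 * field_trace (perp a1 ^+ 2)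
    + 2 * u * v * field_trace (perp a1 * perp a2)
    + v ^+ 2 * field_trace (perp a2 ^+ 2).
  rewrite -!tZ -!tD; congr field_trace.
  rewrite sqrrD !exprZn -scalerAl -scalerAr scalerA -mulrA.
  by rewrite -[_ *+ 2]scaler_nat scalerA.
rewrite !fE; ring.
Qed.

(* Main.v *)
(* Let s be the real embedding and t a complex one, and let L and Q be the real
   linear forms in (x, y) given by s(x a1^perp + y a2^perp) and by the imaginary
   part of t(x a1^perp + y a2^perp). The trace of a^perp is zero, so the real
   part of the latter is - L / 2, whence M = (3/2) L^2 + 2 Q^2 and
   T = (3/2) L^2 - 2 Q^2. Thus M = u^2 + v^2 and T = (u + v)(u - v) for linear
   forms u and v, and the root of M(x, 1) in the upper half-plane lies on the
   geodesic joining the two roots of T(x, 1). This root is the reflection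
   - conj z(M), which is GL_2(Z)-equivalent to z(M). That the trace is the sum of
   the embeddings and that L and Q are independent both come from Dedekind's
   independence of characters. *)

Require Import Defs.
From HB Require Import structures.
From mathcomp Require Import all_boot all_order all_algebra all_field.
From mathcomp Require Import complex.
From mathcomp Require Import mathcomp_extra boolp classical_sets reals.
From mathcomp Require Import ring lra.

Set Implicit Arguments.
Unset Strict Implicit.
Unset Printing Implicit Defensive.

Import Order.TTheory GRing.Theory Num.Theory.
Local Open Scope classical_set_scope.
Local Open Scope ring_scope.

(** * Independence of embeddings, and the trace as their sum *)

(** Induction on the number of nonzero coefficients. Subtracting [sigma i0 x] times the relation at
    [y] from the relation at [x * y] kills the coefficient at [i0] and multiplies each [c j] by
    [sigma j x - sigma i0 x]. *)
Lemma dedekind_independence (I : finType) (K F : fieldType)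
    (sigma : I -> {rmorphism K -> F}) (c : I -> F) :
  (forall i j, sigma i =1 sigma j -> i = j) ->
  (forall x, \sum_i c i * sigma i x = 0) -> forall i, c i = 0.
Proof.
move=> sigma_inj.
have [m] := ubnP #|[pred i | c i != 0]|.
elim: m c => // m IHm c lt_m rel i0.
apply/eqP/negPn/negP => ci0.
have c0 j : j != i0 -> c j = 0.
  move=> ji0.
  have [x neq_x] : exists x, sigma j x != sigma i0 x.
    apply: contrapT => nex; case/eqP: ji0; apply: sigma_inj => x.
    by apply/eqP/negPn/negP => neq_x; apply: nex; exists x.
  have: c j * (sigma j x - sigma i0 x) = 0.
    apply: (IHm (fun i => c i * (sigma i x - sigma i0 x))) => [|y].
      rewrite -ltnS; apply: leq_trans lt_m; rewrite ltnS; apply: proper_card.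
      apply/properP; split.
        apply/fintype.subsetP => i; rewrite !inE; apply: contraNneq => ->.
        by rewrite mul0r.
      by exists i0; rewrite !inE ?subrr ?mulr0 ?eqxx.
    under eq_bigr => i _.
      rewrite -mulrA mulrBl mulrBr -rmorphM [c i * (sigma i0 x * _)]mulrCA.
    over.
    by rewrite sumrB -mulr_sumr !rel mulr0 subrr.
  by move/eqP; rewrite mulf_eq0 subr_eq0 (negPf neq_x) orbF => /eqP.
move: (rel 1); rewrite (bigD1 i0) //= big1 ?addr0 => [|j /c0->]; last exact: mul0r.
by rewrite rmorph1 mulr1 => /eqP; rewrite (negPf ci0).
Qed.

Lemma rmorph_scale_rat (K : fieldExtType rat) (F : numFieldType)
    (s : {rmorphism K -> F}) (c : rat) (a : K) :
  s (c *: a) = ratr c * s a.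
Proof.
rewrite -mulr_algl rmorphM; congr (_ * _).
exact: (fmorph_eq_rat (s \o in_alg K)).
Qed.

Lemma rmorph_comb_rat (K : fieldExtType rat) (F : numFieldType)
    (s : {rmorphism K -> F}) (c d : rat) (a b : K) :
  s (c *: a + d *: b) = ratr c * s a + ratr d * s b.
Proof. by rewrite rmorphD /= !rmorph_scale_rat. Qed.

(** A left kernel vector gives a linear relation between the embeddings on the basis, hence on all
    of [K] by Q-linearity, so Dedekind's lemma makes it zero. *)
Lemma embedding_matrix_unit (K : fieldExtType rat) (F : numFieldType) (n : nat)
    (sigma : 'I_n -> {rmorphism K -> F}) (e : n.-tuple K) :
  (forall i j, sigma i =1 sigma j -> i = j) -> basis_of {:K} e ->
  \matrix_(i < n, j < n) sigma i e`_j \in unitmx.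
Proof.
move=> sigma_inj e_basis; rewrite -row_free_unit; apply: inj_row_free => v v0.
apply/rowP => i; rewrite [RHS]mxE.
apply: (dedekind_independence (c := fun i => v 0 i) sigma_inj) => x.
rewrite (coord_basis e_basis (memvf x)).
under eq_bigr => k _.
  rewrite rmorph_sum mulr_sumr.
  under eq_bigr => j _ do rewrite /= rmorph_scale_rat mulrCA.
over.
rewrite exchange_big big1 //= => j _; rewrite -mulr_sumr.
have := congr1 (fun w : 'rV_n => w 0 j) v0; rewrite !mxE => vj.
rewrite -[X in _ * X = _](_ : \sum_k v 0 k * (\matrix_(i, j) sigma i e`_j) k j = _).
  by rewrite vj mulr0.
by apply: eq_bigr => k _; rewrite mxE.
Qed.

(** The transposed embedding matrix diagonalizes multiplication by [a], with eigenvalues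
    [sigma i a]. *)
Lemma field_trace_sum_embeddings (K : fieldExtType rat) (F : numFieldType)
    (n : nat) (sigma : 'I_n -> {rmorphism K -> F}) (a : K) :
  (forall i j, sigma i =1 sigma j -> i = j) -> \dim {:K} = n ->
  ratr (field_trace a) = \sum_(i < n) sigma i a :> F.
Proof.
move=> sigma_inj dimK; case: _ / dimK in sigma sigma_inj *.
rewrite /field_trace; set e := vbasis _; set A := passmx.mxof e e _.
have e_basis : basis_of {:K} e := vbasisP _.
have S_unit := embedding_matrix_unit sigma_inj e_basis.
move: S_unit; set S := \matrix_(i, j) _ => S_unit.
have ae (j : 'I_(\dim {:K})) : a * e`_j = \sum_k A j k *: e`_k.
  have := passmx.hom_vecof e e_basis (amull a) (delta_mx 0 j).
  rewrite passmx.vecof_delta lfunE /= => ->.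
  by apply: eq_bigr => k _; rewrite -rowE mxE.
have SA : map_mx ratr A *m S^T = S^T *m diag_mx (\row_i sigma i a).
  apply/matrixP => j i; rewrite mul_mx_diag !mxE mulrC -rmorphM ae rmorph_sum.
  by apply: eq_bigr => k _; rewrite !mxE rmorph_scale_rat.
have ST_unit : S^T \in unitmx by rewrite unitmx_tr.
have -> : ratr (\tr A) = \tr (map_mx ratr A) :> F by rewrite trace_map_mx.
rewrite -[map_mx _ _](mulmxK ST_unit) SA -mulmxA mxtrace_mulC -mulmxA.
rewrite mulVmx // mulmx1 mxtrace_diag.
by apply: eq_bigr => i _; rewrite mxE.
Qed.

(** Clearing denominators in a rational relation gives integer coordinates of 0, and these are
    unique because 0 is an algebraic integer. *)
Lemma integral_basis_free (K : fieldExtType rat) (n : nat) (e : n.-tuple K) :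
  integral_basis e -> free e.
Proof.
move=> [_ e_uniq]; apply/freeP => k k0 i.
have [c [_ c_uniq]] : exists! c : 'rV[int]_n, 0 = \sum_(i < n) tnth e i *~ c 0 i.
  by apply: e_uniq; exists 'X; rewrite ?monicX // map_polyX rootX.
have c0 : c = 0.
  by apply: c_uniq; rewrite big1 // => j _; rewrite mxE mulr0z.
pose d := \prod_j denq (k j).
have d_neq0 : d%:Q != 0.
  by rewrite intr_eq0; apply/prodf_neq0 => j _; exact: denq_neq0.
pose z := \row_j (numq (k j) * \prod_(l | l != j) denq (k l)).
have zE j : (z 0 j)%:Q = d%:Q * k j.
  rewrite mxE /d [in RHS](bigD1 j) //= !intrM -[X in _ = _ * X]divq_num_den.
  by field; rewrite intr_eq0 denq_neq0.
have : c = z.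
  apply: c_uniq; transitivity (d%:Q *: \sum_(j < n) k j *: e`_j).
    by rewrite k0 scaler0.
  rewrite scaler_sumr.
  by apply: eq_bigr => j _; rewrite scalerA -zE scaler_int (tnth_nth 0).
rewrite c0 => /rowP/(_ i); rewrite mxE => /esym/(congr1 (fun m : int => m%:Q)).
by rewrite zE => /eqP; rewrite mulf_eq0 (negPf d_neq0) => /eqP.
Qed.

(** * Reflection in the imaginary axis *)

(** The matrix diag(1, -1) has determinant -1 and sends [z] to [- conjc z]. *)
Lemma GL2Z_orbit_oppconj (R : realType) (z : R[i]) :
  GL2Z_orbit (- conjc z) = GL2Z_orbit z.
Proof.
pose d : 'M[int]_2 := diag_mx (\row_j (if j == 0 then 1 else -1)).
have det_d : \det d = -1 by rewrite det_diag !big_ord_recl big_ord0 !mxE.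
have d_unit : d \in unitmx by rewrite unitmxE det_d.
(* One inclusion for all [w] suffices, since the reflection is an involution. *)
have sub (w : R[i]) : GL2Z_orbit (- conjc w) `<=` GL2Z_orbit w.
  move=> _ [g /= g_unit <-].
  exists (g *m d) => /=; first by rewrite unitmx_mul g_unit.
  have gdE i : (g *m d) i 0 = g i 0 /\ (g *m d) i 1 = - g i 1.
    by rewrite mul_mx_diag !mxE /= mulr1 mulrN1.
  rewrite /GL2Z_act !(proj1 (gdE _)) !(proj2 (gdE _)) det_mulmx det_d.
  have fracE (u : R[i]) (a b c e : int) :
      (a%:~R * u + (- b)%:~R) / (c%:~R * u + (- e)%:~R)
      = (a%:~R * - u + b%:~R) / (c%:~R * - u + e%:~R).
    rewrite !intrN -[RHS]divrNN; congr (_ / _); ring.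
  have : (\det g == 1) || (\det g == -1).
    by move: g_unit; rewrite unitmxE.
  case/orP => /eqP ->.
    by rewrite mul1r /= fracE.
  by rewrite mulrNN mulr1 /= fracE raddfN /= conjcK.
apply/seteqP; split; first exact: sub.
have := sub (- conjc z).
by rewrite raddfN /= conjcK opprK.
Qed.

(** * Sums and differences of two squares of real linear forms *)

Lemma posdef_lead_gt0 (R : realType) (Q : bqf R) :
  positive_definite Q -> 0 < bqf_r Q.
Proof.
move=> Qpos; have /Qpos : (1, 0) <> (0, 0) :> R * R.
  by case=> /eqP; rewrite oner_eq0.
by rewrite /bqf_eval expr1n mulr0 expr0n /= !mulr0 mulr1 !addr0.
Qed.

Section SumOfSquares.
Variables (R : realType) (u1 u2 v1 v2 : R).
Let M := Bqf (u1 ^+ 2 + v1 ^+ 2) (2 * (u1 * u2 + v1 * v2)) (u2 ^+ 2 + v2 ^+ 2).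
Let T := Bqf (u1 ^+ 2 - v1 ^+ 2) (2 * (u1 * u2 - v1 * v2)) (u2 ^+ 2 - v2 ^+ 2).

Lemma sum_squares_posdef_det : positive_definite M -> u1 * v2 - u2 * v1 != 0.
Proof.
move=> Mpos; apply/eqP => D0.
have r_gt0 : 0 < u1 ^+ 2 + v1 ^+ 2 := posdef_lead_gt0 Mpos.
(* With r, s, t the coefficients of [M], this is the point (s/2, -r), where [M] takes the value r
   (rt - s^2/4); by Lagrange's identity the second factor is the squared determinant. *)
have /Mpos : (u1 * u2 + v1 * v2, - (u1 ^+ 2 + v1 ^+ 2)) <> (0, 0) :> R * R.
  by case=> _ /eqP; rewrite oppr_eq0 gt_eqF.
rewrite /bqf_eval /=.
set x := (X in 0 < X); have -> : x = (u1 ^+ 2 + v1 ^+ 2) * (u1 * v2 - u2 * v1) ^+ 2.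
  by rewrite /x; ring.
by rewrite D0 expr0n mulr0 ltxx.
Qed.

Lemma diff_squares_indefinite : u1 * v2 - u2 * v1 != 0 -> indefinite T.
Proof.
move=> D0; have D2 : 0 < (u1 * v2 - u2 * v1) ^+ 2 by rewrite exprn_even_gt0.
split.
  (* A zero of the form v = v1 x + v2 y; the negative value below is taken at a zero of u = u1 x +
     u2 y. *)
  exists v2, (- v1); rewrite /bqf_eval /=.
  set x := (X in 0 < X); suff -> : x = (u1 * v2 - u2 * v1) ^+ 2 by [].
  by rewrite /x; ring.
exists u2, (- u1); rewrite /bqf_eval /=.
set x := (X in X < 0); suff -> : x = - (u1 * v2 - u2 * v1) ^+ 2 by rewrite oppr_lt0.
by rewrite /x; ring.
Qed.

Lemma oppconj_bqf_point_geodesic :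
  positive_definite M -> geodesic T (- conjc (bqf_point M)).
Proof.
move=> Mpos; have D0 := sum_squares_posdef_det Mpos.
have r_gt0 : 0 < u1 ^+ 2 + v1 ^+ 2 := posdef_lead_gt0 Mpos.
have z_in := bqf_point_in Mpos.
(* Squaring avoids the sign of the determinant: 4rt - s^2 is the square of twice it. *)
have ImM : complex.Im (bqf_point M) ^+ 2 =
    ((u1 * v2 - u2 * v1) / (u1 ^+ 2 + v1 ^+ 2)) ^+ 2.
  rewrite /M /bqf_point /= expr_div_n sqr_sqrtr.
    by field; rewrite gt_eqF.
  rewrite [X in 0 <= X](_ : _ = (2 * (u1 * v2 - u2 * v1)) ^+ 2) ?sqr_ge0 //.
  by ring.
have ReM : complex.Re (bqf_point M) = (u1 * u2 + v1 * v2) / (u1 ^+ 2 + v1 ^+ 2).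
  by rewrite /=; field; rewrite gt_eqF.
move: z_in ImM ReM; case: (bqf_point M) => x y; rewrite /upper_half_plane /=.
move=> y_gt0 yE xE.
(* The factors u + v and u - v of [T], followed by a zero of each. *)
exists (u1 + v1, u2 + v2), (u1 - v1, u2 - v2).
exists (- (u2 + v2), u1 + v1), (- (u2 - v2), u1 - v1).
split.
- by move=> a b; rewrite /bqf_eval /lin_eval /=; ring.
- split; last by rewrite /lin_eval /=; ring.
  case=> /eqP; rewrite oppr_eq0 => /eqP e2 e1; case/eqP: D0.
  by rewrite -(addr0_eq e1) -(addr0_eq e2); ring.
- split; last by rewrite /lin_eval /=; ring.
  case=> /eqP; rewrite oppr_eq0 => /eqP e2 e1; case/eqP: D0.
  by rewrite (subr0_eq e1) (subr0_eq e2); ring.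
rewrite /P1_affine /=.
(* A vanishing leading coefficient puts that zero at infinity. Both cannot vanish, as the
   determinant is nonzero; if one does, the geodesic is a vertical line, otherwise a semicircle. *)
have [e1|n1] := eqVneq (u1 + v1) 0; have [e2|n2] := eqVneq (u1 - v1) 0 => /=.
- have v1E := subr0_eq e2; move: e1; rewrite v1E -mulr2n => /eqP.
  rewrite mulrn_eq0 /= => /eqP v10.
  by move: D0; rewrite v1E v10 mulr0 mul0r subrr eqxx.
- split; first by rewrite /upper_half_plane /= opprK.
  have v1E := addr0_eq e1; rewrite -v1E in xE r_gt0 n2 *.
  by rewrite xE; field; rewrite n2 gt_eqF.
- split; first by rewrite /upper_half_plane /= opprK.
  have v1E := subr0_eq e2; rewrite v1E in xE r_gt0 n1 *.
  by rewrite xE; field; rewrite n1 gt_eqF.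
- split; first by rewrite /upper_half_plane /= opprK.
  rewrite opprK subr0.
  (* The squared distance to the centre equals the squared radius. *)
  rewrite [X in Num.sqrt X](_ : _ =
    ((- (u2 + v2) / (u1 + v1) - - (u2 - v2) / (u1 - v1)) / 2) ^+ 2).
    by rewrite sqrtr_sqr normrM [`|_^-1|]ger0_norm // invr_ge0.
  rewrite yE xE; field.
  by rewrite n1 n2 gt_eqF.
Qed.

End SumOfSquares.

(** * Embeddings of a complex cubic field *)

Lemma sum_ord3_distinct (A : nmodType) (F : 'I_3 -> A) (i j k : 'I_3) :
  uniq [:: i; j; k] -> \sum_l F l = F i + F j + F k.
Proof.
move=> ijk; rewrite -addrA -[X in _ + (_ + X)]addr0.
transitivity (\sum_(l <- [:: i; j; k]) F l); last by rewrite !big_cons big_nil.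
rewrite [RHS]big_uniq //=.
apply: eq_bigl => l; apply: esym; move: l.
apply/subset_cardP; last exact: fintype.subset_predT.
by rewrite card_ord; exact/card_uniqP.
Qed.

(** The real embedding, a non-real one and its conjugate are pairwise distinct, so they exhaust the
    three indices. A general [G] covers both traces and sums of squared absolute values. *)
Lemma sum_complex_cubic_embeddings (R : realType) (K : fieldExtType rat)
    (sigma : 'I_3 -> {rmorphism K -> R[i]}) :
  complex_cubic_field R K -> all_embeddings sigma ->
  exists s t : {rmorphism K -> R[i]}, real_embedding s /\
    forall (A : nmodType) (G : R[i] -> A) (a : K),
      \sum_i G (sigma i a) = G (s a) + G (t a) + G (conjc (t a)).
Proof.
move=> [_ [s [s_real _]] [t [t_nreal _]]] [sigma_inj sigma_surj].
exists s, t; split=> // A G a.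
pose tc : {rmorphism K -> R[i]} := @conjc R \o t.
have [i si] := sigma_surj s; have [j tj] := sigma_surj t.
have [k tk] := sigma_surj tc.
rewrite (@sum_ord3_distinct _ _ i j k); first by rewrite -si -tj -tk.
have ij : i != j by apply/eqP => e; apply: t_nreal => b; rewrite tj -e -si.
have tc_nreal b : tc b \is Num.real -> t b \is Num.real.
  by rewrite /tc /=; case: (t b) => x y; rewrite !complex_real oppr_eq0.
have ik : i != k.
  by apply/eqP => e; apply: t_nreal => b; apply: tc_nreal; rewrite tk -e -si.
have jk : j != k.
  apply/eqP => e; apply: t_nreal => b.
  have : t b = tc b by rewrite tj e -tk.
  rewrite /tc /=; case: (t b) => x y [] /eqP.
  by rewrite -addr_eq0 -mulr2n mulrn_eq0 complex_real.
by rewrite /= !inE negb_or ij ik jk.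
Qed.

Lemma sum_embeddings_perp (K : fieldExtType rat) (F : numFieldType)
    (sigma : 'I_3 -> {rmorphism K -> F}) (a : K) :
  (forall i j, sigma i =1 sigma j -> i = j) -> \dim {:K} = 3%N ->
  \sum_i sigma i (perp a) = 0.
Proof.
move=> sigma_inj dimK; rewrite /perp.
under eq_bigr => i _ do
  rewrite rmorphB /= !rmorph_scale_rat rmorph1 mulr1
    (field_trace_sum_embeddings a sigma_inj dimK).
by rewrite sumrB -mulr_sumr sumr_const card_ord ratr_nat mulr_natl subrr.
Qed.

Lemma normc_sqr (R : realType) (p q : R) :
  Normc.normc (p +i* q)%C ^+ 2 = p ^+ 2 + q ^+ 2.
Proof. by rewrite /= sqr_sqrtr // addr_ge0 ?sqr_ge0. Qed.

(** At real arguments too the form is a sum of squared absolute values; if all of these vanish,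
    invertibility of the embedding matrix forces both arguments to be zero. *)
Lemma minkowski_form_posdef (R : realType) (K : fieldExtType rat)
    (sigma : 'I_3 -> {rmorphism K -> R[i]}) (a1 a2 : K) :
  (forall i j, sigma i =1 sigma j -> i = j) ->
  basis_of {:K} [tuple 1; a1; a2] ->
  positive_definite (minkowski_form sigma a1 a2).
Proof.
move=> sigma_inj e_basis x y xy0.
pose f i := (x%:C * sigma i (perp a1) + y%:C * sigma i (perp a2))%C.
have -> : bqf_eval (minkowski_form sigma a1 a2) x y =
    \sum_i Normc.normc (f i) ^+ 2.
  rewrite /bqf_eval /minkowski_form /bqf_of_fun /= -!sumrB !mulr_suml.
  rewrite -!big_split /=; apply: eq_bigr => i _; rewrite /f.
  rewrite !rmorph_comb_rat !rmorph0 !rmorph1 !mul0r !mul1r addr0 add0r.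
  case: (sigma i (perp a1)) (sigma i (perp a2)) => [a b] [c d]; simpc.
  by rewrite !normc_sqr; ring.
have sq_ge0 i : true -> 0 <= Normc.normc (f i) ^+ 2 by rewrite sqr_ge0.
rewrite lt_neqAle sumr_ge0 // andbT eq_sym; apply/negP => /eqP sum0.
have f0 i : f i = 0.
  apply: Normc.eq0_normc; apply/eqP; rewrite -sqrf_eq0; apply/eqP.
  exact: (psumr_eq0P sq_ge0 sum0).
(* The coordinates of x a1^perp + y a2^perp in the basis 1, a1, a2. *)
pose w : 'cV[R[i]]_3 := \col_j [tuple
  - (x%:C * ratr (field_trace a1) + y%:C * ratr (field_trace a2));
  3 * x%:C; 3 * y%:C]%C`_j.
(* The embedding matrix sends [w] to the vector of the [f i], which is zero. *)
have w0 : w = 0.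
  have S_unit := embedding_matrix_unit sigma_inj e_basis.
  apply: (can_inj (mulKmx S_unit)); rewrite mulmx0.
  apply/colP => i; rewrite !mxE !big_ord_recl big_ord0 !mxE /= -[RHS](f0 i) /f /perp.
  by rewrite !rmorphB /= !rmorph_scale_rat rmorph1 ratr_nat; ring.
apply: xy0.
have /colP/(_ 1) := w0; have /colP/(_ (inord 2)) := w0.
rewrite !mxE inordK //= => /eqP; rewrite mulf_eq0 pnatr_eq0 => /eqP [->] /eqP.
by rewrite mulf_eq0 pnatr_eq0 => /eqP [->].
Qed.

Theorem theoremB (R : realType) (K : fieldExtType rat)
    (sigma : 'I_3 -> {rmorphism K -> R[i]}) (a1 a2 : K)
    (hK : complex_cubic_field R K)
    (hsigma : all_embeddings sigma)
    (hbasis : integral_basis [tuple 1; a1; a2]) :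
  let M : bqf R := minkowski_form sigma a1 a2 in
  let T : bqf R := map_bqf ratr (trace_zero_form a1 a2) in
  [/\ positive_definite M, indefinite T &
      (@GL2Z_orbit R @` geodesic T) (GL2Z_orbit (bqf_point M))].
Proof.
move=> M T.
have dimK : \dim {:K} = 3%N by case: hK.
have sigma_inj := proj1 hsigma.
have e_basis : basis_of {:K} [tuple 1; a1; a2].
  by rewrite basisEfree integral_basis_free // subvf dimK.
have Mpos : positive_definite M := minkowski_form_posdef sigma_inj e_basis.
have [s [t [s_real sumE]]] := sum_complex_cubic_embeddings hK hsigma.
pose l a := complex.Re (s a); pose q a := complex.Im (t a).
have sE a : s a = (l a)%:C%C by rewrite RRe_real.
have tE a : t (perp a) = (- (l (perp a) / 2) +i* q (perp a))%C.
  have := sum_embeddings_perp a sigma_inj dimK.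
  rewrite (sumE _ id) sE /q; case: (t (perp a)) => x y; simpc.
  move=> /(congr1 (@complex.Re R)) /= xE.
  by congr (_ +i* _)%C => //; lra.
(* The square roots absorb the coefficients 3/2 and 2, leaving pure squares in both forms. *)
pose u a : R := Num.sqrt (3 / 2) * l a; pose v a : R := Num.sqrt 2 * q a.
have uM a b : u a * u b = 3 / 2 * (l a * l b).
  by rewrite /u mulrACA -expr2 sqr_sqrtr // divr_ge0.
have vM a b : v a * v b = 2 * (q a * q b).
  by rewrite /v mulrACA -expr2 sqr_sqrtr.
have ME : M = Bqf (u (perp a1) ^+ 2 + v (perp a1) ^+ 2)
    (2 * (u (perp a1) * u (perp a2) + v (perp a1) * v (perp a2)))
    (u (perp a2) ^+ 2 + v (perp a2) ^+ 2).
  rewrite /M /minkowski_form /bqf_of_fun.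
  rewrite !(sumE _ (fun z => Normc.normc z ^+ 2)).
  rewrite !rmorph_comb_rat !rmorph0 !rmorph1 !mul0r !mul1r addr0 add0r.
  rewrite !sE !tE; simpc; rewrite !normc_sqr !expr2 !uM !vM.
  by congr Bqf; field.
have TE : T = Bqf (u (perp a1) ^+ 2 - v (perp a1) ^+ 2)
    (2 * (u (perp a1) * u (perp a2) - v (perp a1) * v (perp a2)))
    (u (perp a2) ^+ 2 - v (perp a2) ^+ 2).
  (* The trace is a sum of complex numbers; the identity is pulled back to [R] along the inclusion
     into [R[i]]. *)
  have trE a : ratr (field_trace a) = l a + 2 * complex.Re (t a) :> R.
    apply: (@complexI R).
    rewrite (_ : (ratr _)%:C%C = ratr (field_trace a)); last exact: fmorph_rat.
    rewrite (field_trace_sum_embeddings a sigma_inj dimK) (sumE _ id) sE.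
    case: (t a) => x y; simpc; rewrite complexr0; congr (_%:C)%C => /=; ring.
  have lM a b : l (a * b) = l a * l b.
    by rewrite /l rmorphM !sE /=; simpc.
  rewrite /T /trace_zero_form /bqf_of_fun /map_bqf /=.
  move: (tE a1) (tE a2); move: (perp a1) (perp a2) => b1 b2 tE1 tE2.
  rewrite !scale0r !scale1r addr0 add0r !rmorphB /= !trE !expr2 !lM !rmorphM.
  have lD a b : l (a + b) = l a + l b by rewrite /l rmorphD raddfD.
  rewrite !lD !rmorphD /= !tE1 !tE2; simpc; rewrite /= !uM !vM.
  by congr Bqf; field.
rewrite ME in Mpos *; rewrite TE; split=> //.
  exact/diff_squares_indefinite/sum_squares_posdef_det.
(* The reflected point is the representative that lies on the geodesic itself. *)
exists (- conjc (bqf_point M)); last by rewrite GL2Z_orbit_oppconj ME.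
by rewrite ME; exact: oppconj_bqf_point_geodesic.
Qed.
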